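(* Let $G$ be a Hurwitz $C$-group of degree $m$. Then its Alexander polynomial $\Delta(t)$ divides the polynomial $(t-1)(t^m-1)^{m-2}$.
   Context: $C$-groups. A $C$-group is a group $G$ together with a finite presentation $\langle x_1,\dots,x_m\mid x_i=w_{i,j,k}^{-1}x_jw_{i,j,k}\rangle$ (a $C$-presentation), where the $w_{i,j,k}$ ($1\le i,j\le m$, $1\le k\le h(i,j)$, $h:\{1,\dots,m\}^2\to\mathbb Z$ some function) are certain elements of the free group on $x_1,\dots,x_m$ (all relations are conjugations of generators). The images of the $x_i$ in $G$ and all their conjugates are the $C$-generators of $G$. A $C$-presentation is a Hurwitz $C$-presentation of degree $m$ if for each $i=1,\dots,m$ the word $w_{i,i,1}$ is the product $x_1\cdots x_m$; a $C$-group is a Hurwitz $C$-group of degree $m$ if it possesses a Hurwitz $C$-presentation of degree $m$, in other words, if it is generated by $C$-generators $x_1,\dots,x_m$ such that $x_1\cdots x_m$ belongs to the centre of $G$. $C$-groups are considered up to isomorphisms sending $C$-generators to $C$-generators. Alexander polynomial. $\mathbb F_1$ is the infinite cyclic group with its fixed generator; $\nu:G\to\mathbb F_1$ is the epimorphism sending every $C$-generator to the generator of $\mathbb F_1$; $N=\ker\nu$, $N'$ is its commutator subgroup. The generator of $\mathbb F_1$ acts on $N/N'$ by $h:b\mapsto\tilde x^{-1}b\tilde x$, where $\tilde x$ is any $C$-generator; $h_{\mathbb C}$ is the induced automorphism of $(N/N')\otimes\mathbb C$. The Alexander polynomial of $G$ is $\Delta(t)=\det(h_{\mathbb C}-t\,\mathrm{Id})$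 (and $\Delta\equiv0$ if $(N/N')\otimes\mathbb C$ is infinite dimensional). *)

(* Defs.v *)
From HB Require Import structures.
From mathcomp Require Import all_boot all_order all_algebra.
From mathcomp Require Import complex.
From mathcomp Require Import boolp classical_sets reals.

Set Implicit Arguments.
Unset Strict Implicit.
Unset Printing Implicit Defensive.

Import Order.TTheory GRing.Theory Num.Theory.

Local Open Scope quotient_scope.
Local Open Scope classical_set_scope.
Local Open Scope ring_scope.
Local Open Scope group_scope.

Section Subgroups.
Variable H : groupType.

Definition is_subgroup (A : set H) : Prop :=
  A 1 /\ forall x y, A x -> A y -> A (x / y).

Definition is_normal (A : set H) : Prop :=
  is_subgroup A /\ forall x y, A x -> A (x ^ y).

Definition gen_subgroup (S : set H) : set H :=
  [set g | forall A, is_subgroup A -> S `<=` A -> A g].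

Definition normal_closure (S : set H) : set H :=
  [set g | forall A, is_normal A -> S `<=` A -> A g].

Definition derived_subgroup : set H :=
  gen_subgroup [set g | exists x y : H, g = [~ x, y]].

Lemma is_subgroupV A x : is_subgroup A -> A x -> A x^-1.
Proof. by case=> A1 AF Ax; rewrite -[x^-1]mul1g; exact: AF. Qed.

Lemma is_subgroupM A x y : is_subgroup A -> A x -> A y -> A (x * y).
Proof.
move=> sA Ax Ay; rewrite -[y]invgK; case: (sA) => _; apply=> //.
exact: is_subgroupV.
Qed.

Lemma derived_is_subgroup : is_subgroup derived_subgroup.
Proof.
split=> [A [A1 _] _ //|x y Dx Dy A sA SA] /=.
by case: (sA) => _; apply; [exact: Dx A sA SA | exact: Dy A sA SA].
Qed.

Lemma derived_commg x y : derived_subgroup [~ x, y].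
Proof. by move=> A _ SA; apply: SA; exists x, y. Qed.

Lemma derived_normal : is_normal derived_subgroup.
Proof.
split=> [|x y Dx]; first exact: derived_is_subgroup.
have -> : x ^ y = x * [~ x, y] by rewrite commgEl mulVKg.
exact: (is_subgroupM derived_is_subgroup Dx (derived_commg x y)).
Qed.

End Subgroups.

Section FreeGroup.
Variable m : nat.

(* The letter (i, true) stands for x_i and (i, false) for its inverse. *)
Definition word := seq ('I_m * bool).

Implicit Types u v w : word.

Definition flip (a : 'I_m * bool) : 'I_m * bool := (a.1, ~~ a.2).

Inductive free_eq : word -> word -> Prop :=
| free_eq_refl u : free_eq u u
| free_eq_sym u v : free_eq u v -> free_eq v u
| free_eq_trans u v w : free_eq u v -> free_eq v w -> free_eq u w
| free_eq_cancel u v a : free_eq (u ++ [:: a, flip a & v]) (u ++ v).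

Definition free_eqb u v : bool := `[< free_eq u v >].

Lemma free_eqb_refl : reflexive free_eqb.
Proof. by move=> u; apply/asboolP; apply: free_eq_refl. Qed.

Lemma free_eqb_sym : symmetric free_eqb.
Proof. by move=> u v; apply/asboolP/asboolP; apply: free_eq_sym. Qed.

Lemma free_eqb_trans : transitive free_eqb.
Proof.
by move=> v u w /asboolP uv /asboolP vw; apply/asboolP/(free_eq_trans uv vw).
Qed.

Canonical free_equiv := EquivRel free_eqb free_eqb_refl free_eqb_sym free_eqb_trans.

Definition free_group := {eq_quot free_equiv}.

HB.instance Definition _ := Choice.on free_group.
HB.instance Definition _ := EqQuotient.on free_group.

Definition free_of_word u : free_group := \pi_free_group u.

Lemma free_of_wordP u v : free_of_word u = free_of_word v <-> free_eq u v.
Proof. by split=> [/eqmodP/asboolP //|uv]; apply/eqmodP/asboolP. Qed.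

Lemma free_of_wordK (a : free_group) : free_of_word (repr a) = a.
Proof. exact: reprK. Qed.

Lemma free_eq_repr u : free_eq (repr (free_of_word u)) u.
Proof. by apply/free_of_wordP; rewrite free_of_wordK. Qed.

Lemma free_eq_catl w u v : free_eq u v -> free_eq (w ++ u) (w ++ v).
Proof.
elim=> {u v} [u|u v _ IH|u v z _ IH1 _ IH2|u v a].
- exact: free_eq_refl.
- exact: free_eq_sym.
- exact: free_eq_trans IH1 IH2.
- by rewrite !catA; apply: free_eq_cancel.
Qed.

Lemma free_eq_catr w u v : free_eq u v -> free_eq (u ++ w) (v ++ w).
Proof.
elim=> {u v} [u|u v _ IH|u v z _ IH1 _ IH2|u v a].
- exact: free_eq_refl.
- exact: free_eq_sym.
- exact: free_eq_trans IH1 IH2.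
- by rewrite -!catA; apply: free_eq_cancel.
Qed.

Lemma free_eq_cat u u' v v' :
  free_eq u u' -> free_eq v v' -> free_eq (u ++ v) (u' ++ v').
Proof.
by move=> uu' vv'; apply: free_eq_trans (free_eq_catr v uu') (free_eq_catl u' vv').
Qed.

Definition word_inv u : word := rev (map flip u).

Lemma flipK : involutive flip.
Proof. by case=> i b; rewrite /flip negbK. Qed.

Lemma word_inv_cat u v : word_inv (u ++ v) = word_inv v ++ word_inv u.
Proof. by rewrite /word_inv map_cat rev_cat. Qed.

Lemma free_eq_inv u v : free_eq u v -> free_eq (word_inv u) (word_inv v).
Proof.
elim=> {u v} [u|u v _ IH|u v z _ IH1 _ IH2|u v a].
- exact: free_eq_refl.
- exact: free_eq_sym.
- exact: free_eq_trans IH1 IH2.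
have -> : word_inv (u ++ [:: a, flip a & v]) =
    word_inv v ++ [:: a, flip a & word_inv u].
  by rewrite word_inv_cat /word_inv /= flipK !rev_cons -!cats1 -!catA.
rewrite word_inv_cat; exact: free_eq_cancel.
Qed.

Lemma free_eq_mulV u : free_eq (u ++ word_inv u) [::].
Proof.
elim/last_ind: u => [|u a IH]; first exact: free_eq_refl.
rewrite -cats1 word_inv_cat -catA /=.
apply: free_eq_trans IH; exact: free_eq_cancel.
Qed.

Lemma word_invK : involutive word_inv.
Proof. by move=> u; rewrite /word_inv map_rev revK mapK //; apply: flipK. Qed.

Lemma free_eq_Vmul u : free_eq (word_inv u ++ u) [::].
Proof. by rewrite -{2}[u]word_invK; apply: free_eq_mulV. Qed.

Definition free_mul (a b : free_group) : free_group :=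
  free_of_word (repr a ++ repr b).
Definition free_inv (a : free_group) : free_group :=
  free_of_word (word_inv (repr a)).
Definition free_one : free_group := free_of_word [::].

Lemma free_mul_word u v :
  free_mul (free_of_word u) (free_of_word v) = free_of_word (u ++ v).
Proof. by apply/free_of_wordP/free_eq_cat; apply: free_eq_repr. Qed.

Lemma free_inv_word u : free_inv (free_of_word u) = free_of_word (word_inv u).
Proof. by apply/free_of_wordP/free_eq_inv/free_eq_repr. Qed.

Lemma free_mulA : associative free_mul.
Proof.
move=> a b c; rewrite -(free_of_wordK a) -(free_of_wordK b) -(free_of_wordK c).
by rewrite !free_mul_word catA.
Qed.

Lemma free_mul1 : left_id free_one free_mul.
Proof. by move=> a; rewrite -(free_of_wordK a) free_mul_word. Qed.

Lemma free_mulr1 : right_id free_one free_mul.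
Proof. by move=> a; rewrite -(free_of_wordK a) free_mul_word cats0. Qed.

Lemma free_mulV : left_inverse free_one free_inv free_mul.
Proof.
move=> a; rewrite -(free_of_wordK a) free_inv_word free_mul_word.
by apply/free_of_wordP/free_eq_Vmul.
Qed.

Lemma free_mulrV : right_inverse free_one free_inv free_mul.
Proof.
move=> a; rewrite -(free_of_wordK a) free_inv_word free_mul_word.
by apply/free_of_wordP/free_eq_mulV.
Qed.

HB.instance Definition _ := isGroup.Build free_group
  free_mulA free_mul1 free_mulr1 free_mulV free_mulrV.

Definition free_gen (i : 'I_m) : free_group := free_of_word [:: (i, true)].

Variables (G : groupType) (x : 'I_m -> G).

Definition word_eval u : G :=
  \prod_(a <- u) (if a.2 then x a.1 else (x a.1)^-1).

Definition free_lift (a : free_group) : G := word_eval (repr a).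

Lemma word_eval_eq u v : free_eq u v -> word_eval u = word_eval v.
Proof.
elim=> {u v} [//|u v _ -> //|u v z _ -> _ -> //|u v [i b]].
rewrite /word_eval !big_cat !big_cons /=; congr (_ * _).
by case: b => /=; rewrite ?mulVKg ?mulKg.
Qed.

Lemma free_lift_word u : free_lift (free_of_word u) = word_eval u.
Proof. exact/word_eval_eq/free_eq_repr. Qed.

Lemma free_liftM : {morph free_lift : a b / a * b}.
Proof. by move=> a b; rewrite free_lift_word /word_eval big_cat. Qed.

Lemma free_lift1 : free_lift 1 = 1.
Proof. by rewrite free_lift_word /word_eval big_nil. Qed.

Lemma free_lift_gen i : free_lift (free_gen i) = x i.
Proof. by rewrite free_lift_word /word_eval big_seq1. Qed.

HB.instance Definition _ :=
  isUMagmaMorphism.Build free_group G free_lift (conj free_lift1 free_liftM).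

Lemma free_liftV : {morph free_lift : a / a^-1}.
Proof. exact: gmulfV. Qed.

Lemma free_liftJ : {morph free_lift : a b / a ^ b}.
Proof. exact: gmulfJ. Qed.

End FreeGroup.

Section CPresentations.

(* The relations are x_i = w^-1 x_j w for w = cp_word i j k; in group_scope,
   g ^ w is w^-1 * g * w.  The indices i, j, k start at 0. *)
Record c_presentation (m : nat) := CPresentation {
  cp_num : 'I_m -> 'I_m -> nat;
  cp_word : forall i j : 'I_m, 'I_(cp_num i j) -> free_group m
}.

Variable m : nat.
Implicit Type P : c_presentation m.

Definition cp_relators P : set (free_group m) :=
  [set r | exists i j (k : 'I_(cp_num P i j)),
     r = (free_gen i)^-1 * free_gen j ^ cp_word k].

Definition presents (G : groupType) (x : 'I_m -> G) (S : set (free_group m)) :=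
  (forall g, exists a, free_lift x a = g) /\
  (forall a, free_lift x a = 1 <-> normal_closure S a).

Definition hurwitz_presentation P : Prop :=
  forall i, exists2 k : 'I_(cp_num P i i),
    k = 0%N :> nat & cp_word k = \prod_(j < m) free_gen j.

Definition c_presents (G : groupType) (C : set G) P : Prop :=
  exists2 x : 'I_m -> G, presents x (cp_relators P) &
    C = [set g | exists i y, g = x i ^ y].

End CPresentations.

(* As C-groups are taken up to isomorphisms that preserve C-generators, the
   structure consists of the set of C-generators, not of a presentation.  At
   least one generator is needed for the map onto the infinite cyclic group
   to exist. *)
Record cGroup := CGroup {
  cg_sort :> groupType;
  cg_gens : set cg_sort;
  cg_presented : exists m (P : c_presentation m),
    (0 < m)%N /\ c_presents cg_gens P
}.

Definition hurwitz_cgroup (m : nat) (G : cGroup) : Prop :=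
  exists2 P : c_presentation m, hurwitz_presentation P & c_presents (@cg_gens G) P.

Section Nu.

(* The infinite cyclic group is the additive group int, with generator 1; f is
   unique because the C-generators generate G. *)
Definition is_nu (G : cGroup) (f : G -> int) : Prop :=
  {morph f : x y / x * y >-> (x + y)%R} /\ forall c, cg_gens c -> f c = 1%R.

Definition word_degree m (u : word m) : int :=
  (\sum_(a <- u) (if a.2 then 1 else -1))%R.

Lemma word_degree_eq m (u v : word m) : free_eq u v -> word_degree u = word_degree v.
Proof.
elim=> {u v} [//|u v _ -> //|u v z _ -> _ -> //|u v [i b]].
rewrite /word_degree !big_cat !big_cons /=; congr (_ + _)%R.
by case: b => /=; rewrite ?addKr ?addNKr.
Qed.

Definition free_degree m (a : free_group m) : int := word_degree (repr a).

Lemma free_degree_word m (u : word m) : free_degree (free_of_word u) = word_degree u.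
Proof. exact/word_degree_eq/free_eq_repr. Qed.

Lemma free_degreeM m : {morph @free_degree m : a b / a * b >-> (a + b)%R}.
Proof. by move=> a b; rewrite free_degree_word /word_degree big_cat. Qed.

Lemma free_degree1 m : free_degree (1 : free_group m) = 0%R.
Proof. by rewrite free_degree_word /word_degree big_nil. Qed.

Lemma free_degreeV m (a : free_group m) : free_degree a^-1 = (- free_degree a)%R.
Proof.
by apply/eqP; rewrite -addr_eq0 -free_degreeM mulVg free_degree1.
Qed.

Lemma free_degreeJ m (a b : free_group m) : free_degree (a ^ b) = free_degree a.
Proof. by rewrite /conjg !free_degreeM free_degreeV addrC addrK. Qed.

Lemma free_degree_gen m (i : 'I_m) : free_degree (free_gen i) = 1%R.
Proof. by rewrite free_degree_word /word_degree big_seq1. Qed.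

Lemma free_degree_relators m (P : c_presentation m) a :
  normal_closure (cp_relators P) a -> free_degree a = 0%R.
Proof.
move=> na; apply: (na [set b | free_degree b = 0%R]); first split; first split.
- exact: free_degree1.
- by move=> b c /= eb ec; rewrite free_degreeM free_degreeV eb ec subr0.
- by move=> b c /= eb; rewrite free_degreeJ.
- move=> _ [i [j [k ->]]] /=.
  by rewrite free_degreeM free_degreeV free_degreeJ !free_degree_gen addNr.
Qed.

Lemma nu_exists (G : cGroup) : exists f : G -> int, is_nu f.
Proof.
have [m [P [_ [x [xsurj xker] Cx]]]] := cg_presented G.
pose pre (g : G) := projT1 (cid (xsurj g)).
have preK g : free_lift x (pre g) = g by rewrite /pre; case: cid.
have degE a g : free_lift x a = g -> free_degree (pre g) = free_degree a.
  move=> ag; apply/eqP; rewrite -subr_eq0 -free_degreeV -free_degreeM; apply/eqP.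
  apply: (@free_degree_relators m P); apply/xker.
  by rewrite free_liftM free_liftV preK ag mulgV.
exists (fun g => free_degree (pre g)); split=> [g g'|c].
  by rewrite -free_degreeM; apply: degE; rewrite free_liftM !preK.
rewrite Cx => -[i [y ->]].
rewrite (degE (free_gen i ^ pre y)) ?free_degreeJ ?free_degree_gen //.
by rewrite free_liftJ preK free_lift_gen.
Qed.

Variable G : cGroup.

Definition nu : G -> int := projT1 (cid (nu_exists G)).

Lemma nuP : is_nu nu.
Proof. by rewrite /nu; case: cid. Qed.

Lemma nuM : {morph nu : x y / x * y >-> (x + y)%R}.
Proof. exact: nuP.1. Qed.

Lemma nu_gen c : cg_gens c -> nu c = 1%R.
Proof. exact: nuP.2. Qed.

Lemma nu1 : nu 1 = 0%R.
Proof. by apply: (addrI (nu 1)); rewrite -nuM mulg1 addr0. Qed.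

Lemma nuV x : nu x^-1 = (- nu x)%R.
Proof. by apply/eqP; rewrite -addr_eq0 -nuM mulVg nu1. Qed.

Lemma nuJ x y : nu (x ^ y) = nu x.
Proof. by rewrite /conjg !nuM nuV addrC addrK. Qed.

Definition in_ker_nu : pred G := fun x => nu x == 0%R.

Lemma ker_nu_closed : group_closed in_ker_nu.
Proof.
split=> [|x y]; first by rewrite unfold_in /in_ker_nu nu1.
rewrite !unfold_in /in_ker_nu => /eqP x0 /eqP y0.
by rewrite nuM nuV x0 y0 subr0.
Qed.

Definition ker_nu := {x : G | in_ker_nu x}.

HB.instance Definition _ := SubChoice.on ker_nu.
HB.instance Definition _ := SubChoice_isSubGroup.Build G in_ker_nu ker_nu ker_nu_closed.

Lemma ker_conj_subproof (c : G) (b : ker_nu) : in_ker_nu (val b ^ c).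
Proof. by rewrite /in_ker_nu nuJ; exact: valP b. Qed.

Definition ker_conj (c : G) (b : ker_nu) : ker_nu := Sub (val b ^ c) (ker_conj_subproof c b).

Lemma ker_conjM c : {morph ker_conj c : a b / a * b}.
Proof. by move=> a b; apply: val_inj; rewrite !(SubK, valM) /= conjMg. Qed.

Lemma ker_conj1 c : ker_conj c 1 = 1.
Proof. by apply: val_inj; rewrite /= conj1g. Qed.

HB.instance Definition _ c := isUMagmaMorphism.Build ker_nu ker_nu (ker_conj c)
  (conj (ker_conj1 c) (ker_conjM c)).

Lemma cgen_exists : exists c : G, cg_gens c.
Proof.
have [m [P [m_gt0 [x _ ->]]]] := cg_presented G.
by exists (x (Ordinal m_gt0)), (Ordinal m_gt0), 1; rewrite conjg1.
Qed.

Definition some_cgen : G := projT1 (cid cgen_exists).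

Lemma some_cgenP : cg_gens some_cgen.
Proof. by rewrite /some_cgen; case: cid. Qed.

End Nu.

Section Abelianization.
Variable H : groupType.

Definition ab_eqb (x y : H) : bool := `[< derived_subgroup (x^-1 * y) >].

Lemma ab_eqb_refl : reflexive ab_eqb.
Proof.
by move=> x; apply/asboolP; rewrite mulVg; apply: (derived_is_subgroup H).1.
Qed.

Lemma ab_eqb_sym : symmetric ab_eqb.
Proof.
move=> x y; apply/asboolP/asboolP => /(is_subgroupV (derived_is_subgroup H));
  by rewrite invgM invgK.
Qed.

Lemma ab_eqb_trans : transitive ab_eqb.
Proof.
move=> y x z /asboolP xy /asboolP yz; apply/asboolP.
have := is_subgroupM (derived_is_subgroup H) xy yz.
by rewrite -mulgA mulVKg.
Qed.

Canonical ab_equiv := EquivRel ab_eqb ab_eqb_refl ab_eqb_sym ab_eqb_trans.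

Definition abelianization := {eq_quot ab_equiv}.

HB.instance Definition _ := Choice.on abelianization.
HB.instance Definition _ := EqQuotient.on abelianization.

Definition ab_class (x : H) : abelianization := \pi_abelianization x.

Lemma ab_classP x y : ab_class x = ab_class y <-> derived_subgroup (x^-1 * y).
Proof. by split=> [/eqmodP/asboolP //|xy]; apply/eqmodP/asboolP. Qed.

Lemma ab_classK (a : abelianization) : ab_class (repr a) = a.
Proof. exact: reprK. Qed.

Definition ab_add (a b : abelianization) := ab_class (repr a * repr b).
Definition ab_opp (a : abelianization) := ab_class (repr a)^-1.
Definition ab_zero := ab_class 1.

Lemma ab_class_mul x x' y y' : ab_class x = ab_class x' ->
  ab_class y = ab_class y' -> ab_class (x * y) = ab_class (x' * y').
Proof.
move=> /ab_classP xx' /ab_classP yy'; apply/ab_classP.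
have -> : (x * y)^-1 * (x' * y') = (x^-1 * x') ^ y * (y^-1 * y').
  by rewrite invgM /conjg -!mulgA mulVKg.
by apply: (is_subgroupM (derived_is_subgroup H)) => //; apply: (derived_normal H).2.
Qed.

Lemma ab_addE x y : ab_add (ab_class x) (ab_class y) = ab_class (x * y).
Proof. by apply: ab_class_mul; rewrite ab_classK. Qed.

Lemma ab_mulC x y : ab_class (x * y) = ab_class (y * x).
Proof.
apply/ab_classP; suff -> : (x * y)^-1 * (y * x) = [~ y, x] by exact: derived_commg.
by rewrite invgM /commg /conjg -!mulgA.
Qed.

Lemma ab_addA : associative ab_add.
Proof.
move=> a b c; rewrite -(ab_classK a) -(ab_classK b) -(ab_classK c).
by rewrite !ab_addE mulgA.
Qed.

Lemma ab_addC : commutative ab_add.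
Proof.
by move=> a b; rewrite -(ab_classK a) -(ab_classK b) !ab_addE ab_mulC.
Qed.

Lemma ab_add0 : left_id ab_zero ab_add.
Proof. by move=> a; rewrite -(ab_classK a) ab_addE mul1g. Qed.

Lemma ab_addN : left_inverse ab_zero ab_opp ab_add.
Proof.
by move=> a; rewrite -{2}(ab_classK a) ab_addE mulVg.
Qed.

HB.instance Definition _ :=
  GRing.isZmodule.Build abelianization ab_addA ab_addC ab_add0 ab_addN.

Lemma ab_classM x y : ab_class (x * y) = (ab_class x + ab_class y)%R.
Proof. by rewrite -ab_addE. Qed.

Lemma ab_class1 : ab_class 1 = 0%R.
Proof. by []. Qed.

Lemma ab_classV x : ab_class x^-1 = (- ab_class x)%R.
Proof. by apply/eqP; rewrite -addr_eq0 -ab_classM mulVg. Qed.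

End Abelianization.

Section AbelianizationMap.
Variables H K : groupType.

Definition ab_map (f : H -> K) (a : abelianization H) : abelianization K :=
  ab_class (f (repr a)).

Lemma ab_mapE (f : UMagmaMorphism.type H K) x :
  ab_map f (ab_class x) = ab_class (f x).
Proof.
apply/ab_classP; rewrite -gmulfV -gmulfM.
have /ab_classP : ab_class (repr (ab_class x)) = ab_class x by exact: ab_classK.
move=> na; apply: (na [set z | derived_subgroup (f z)]); first split; rewrite /=.
- by rewrite gmulf1; apply: (derived_is_subgroup K).1.
- move=> y z; rewrite gmulfF; exact: (derived_is_subgroup K).2.
- by move=> _ [y [z ->]] /=; rewrite gmulfR; apply: derived_commg.
Qed.

Lemma ab_mapD (f : UMagmaMorphism.type H K) :
  {morph ab_map f : a b / (a + b)%R}.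
Proof.
move=> a b; rewrite -(ab_classK a) -(ab_classK b) -ab_classM.
by rewrite !ab_mapE gmulfM ab_classM.
Qed.

End AbelianizationMap.

(* Hence the choice made by some_cgen is immaterial in alexander_action below. *)
Lemma ab_map_ker_conj (G : cGroup) (c d : G) : cg_gens c -> cg_gens d ->
  ab_map (@ker_conj G c) = ab_map (@ker_conj G d).
Proof.
move=> cC dC; apply/funext => a; rewrite -(ab_classK a) !ab_mapE.
have cd0 : in_ker_nu (c^-1 * d).
  by rewrite /in_ker_nu nuM nuV !nu_gen // addNr.
pose n : ker_nu G := Sub (c^-1 * d) cd0.
have E : ker_conj d (repr a) = ker_conj c (repr a) ^ n.
  apply: val_inj; rewrite [RHS](gmulfJ val) /=.
  by rewrite -conjgM mulVKg.
by rewrite /= E !ab_classM ab_classV addrCA addNr addr0.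
Qed.

Local Close Scope group_scope.

Section Tensor.
Variables (A : zmodType) (F : fieldType).
Implicit Types s t u : seq (A * F).

(* The list [:: (a1, f1); ...; (an, fn)] stands for the sum of the ai (x) fi;
   the tensor product of A and F over the integers is the quotient of such
   formal sums by the bilinearity relations. *)
Inductive tensor_eq : seq (A * F) -> seq (A * F) -> Prop :=
| tensor_eq_refl s : tensor_eq s s
| tensor_eq_sym s t : tensor_eq s t -> tensor_eq t s
| tensor_eq_trans s t u : tensor_eq s t -> tensor_eq t u -> tensor_eq s u
| tensor_eq_cat s s' t t' :
    tensor_eq s s' -> tensor_eq t t' -> tensor_eq (s ++ t) (s' ++ t')
| tensor_eq_comm s t : tensor_eq (s ++ t) (t ++ s)
| tensor_eq_addl a b f : tensor_eq [:: (a + b, f)] [:: (a, f); (b, f)]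
| tensor_eq_addr a f g : tensor_eq [:: (a, f + g)] [:: (a, f); (a, g)]
| tensor_eq_zero a : tensor_eq [:: (a, 0)] [::].

Definition tensor_eqb s t : bool := `[< tensor_eq s t >].

Lemma tensor_eqb_refl : reflexive tensor_eqb.
Proof. by move=> s; apply/asboolP; apply: tensor_eq_refl. Qed.

Lemma tensor_eqb_sym : symmetric tensor_eqb.
Proof. by move=> s t; apply/asboolP/asboolP; apply: tensor_eq_sym. Qed.

Lemma tensor_eqb_trans : transitive tensor_eqb.
Proof.
by move=> t s u /asboolP st /asboolP tu; apply/asboolP/(tensor_eq_trans st tu).
Qed.

Canonical tensor_equiv :=
  EquivRel tensor_eqb tensor_eqb_refl tensor_eqb_sym tensor_eqb_trans.

Definition tensor := {eq_quot tensor_equiv}.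

HB.instance Definition _ := Choice.on tensor.
HB.instance Definition _ := EqQuotient.on tensor.

Definition tensor_sum s : tensor := \pi_tensor s.

Lemma tensor_sumP s t : tensor_sum s = tensor_sum t <-> tensor_eq s t.
Proof. by split=> [/eqmodP/asboolP //|st]; apply/eqmodP/asboolP. Qed.

Lemma tensor_sumK (v : tensor) : tensor_sum (repr v) = v.
Proof. exact: reprK. Qed.

Lemma tensor_eq_repr s : tensor_eq (repr (tensor_sum s)) s.
Proof. by apply/tensor_sumP; rewrite tensor_sumK. Qed.

Definition scale_sum (c : F) s : seq (A * F) := [seq (p.1, c * p.2) | p <- s].

Lemma tensor_eq_scale c s t :
  tensor_eq s t -> tensor_eq (scale_sum c s) (scale_sum c t).
Proof.
elim=> {s t} [s|s t _ IH|s t u _ IH1 _ IH2|s s' t t' _ IH1 _ IH2|s t|a b f|a f g|a].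
- exact: tensor_eq_refl.
- exact: tensor_eq_sym.
- exact: tensor_eq_trans IH1 IH2.
- by rewrite /scale_sum !map_cat; apply: tensor_eq_cat.
- by rewrite /scale_sum !map_cat; apply: tensor_eq_comm.
- exact: tensor_eq_addl.
- by rewrite /= mulrDr; apply: tensor_eq_addr.
- by rewrite /= mulr0; apply: tensor_eq_zero.
Qed.

Definition tensor_add (v w : tensor) := tensor_sum (repr v ++ repr w).
Definition tensor_scale (c : F) (v : tensor) := tensor_sum (scale_sum c (repr v)).
Definition tensor_opp (v : tensor) := tensor_scale (-1) v.
Definition tensor_zero := tensor_sum [::].

Lemma tensor_addE s t :
  tensor_add (tensor_sum s) (tensor_sum t) = tensor_sum (s ++ t).
Proof. by apply/tensor_sumP/tensor_eq_cat; apply: tensor_eq_repr. Qed.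

Lemma tensor_scaleE c s :
  tensor_scale c (tensor_sum s) = tensor_sum (scale_sum c s).
Proof. exact/tensor_sumP/tensor_eq_scale/tensor_eq_repr. Qed.

Lemma tensor_addA : associative tensor_add.
Proof.
move=> u v w; rewrite -(tensor_sumK u) -(tensor_sumK v) -(tensor_sumK w).
by rewrite !tensor_addE catA.
Qed.

Lemma tensor_addC : commutative tensor_add.
Proof.
move=> u v; rewrite -(tensor_sumK u) -(tensor_sumK v) !tensor_addE.
exact/tensor_sumP/tensor_eq_comm.
Qed.

Lemma tensor_add0 : left_id tensor_zero tensor_add.
Proof. by move=> v; rewrite -(tensor_sumK v) tensor_addE. Qed.

Lemma tensor_eq_scaleD c d s :
  tensor_eq (scale_sum (c + d) s) (scale_sum c s ++ scale_sum d s).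
Proof.
elim: s => [|[a f] s IH] /=; first exact: tensor_eq_refl.
rewrite mulrDl.
apply: (@tensor_eq_trans _ ([:: (a, c * f); (a, d * f)] ++
                            (scale_sum c s ++ scale_sum d s))).
  exact: (tensor_eq_cat (tensor_eq_addr a (c * f) (d * f)) IH).
apply: (@tensor_eq_cat [:: _] [:: _]); first exact: tensor_eq_refl.
have := tensor_eq_cat (tensor_eq_comm [:: (a, d * f)] (scale_sum c s))
  (tensor_eq_refl (scale_sum d s)).
by rewrite -!catA.
Qed.

Lemma tensor_eq_scale0 s : tensor_eq (scale_sum 0 s) [::].
Proof.
elim: s => [|[a f] s IH] /=; first exact: tensor_eq_refl.
rewrite mul0r; exact: (tensor_eq_cat (tensor_eq_zero a) IH).
Qed.

Lemma scale_sum1 s : scale_sum 1 s = s.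
Proof.
by rewrite /scale_sum -[RHS]map_id; apply: eq_map => -[a f]; rewrite mul1r.
Qed.

Lemma tensor_addN : left_inverse tensor_zero tensor_opp tensor_add.
Proof.
move=> v; rewrite -(tensor_sumK v) /tensor_opp tensor_scaleE tensor_addE.
apply/tensor_sumP; rewrite -{2}[repr v]scale_sum1.
apply: tensor_eq_trans (tensor_eq_sym (tensor_eq_scaleD _ _ _)) _.
by rewrite addNr; apply: tensor_eq_scale0.
Qed.

HB.instance Definition _ :=
  GRing.isZmodule.Build tensor tensor_addA tensor_addC tensor_add0 tensor_addN.

Lemma tensor_sum_cat s t : tensor_sum (s ++ t) = tensor_sum s + tensor_sum t.
Proof. by rewrite -tensor_addE. Qed.

Lemma tensor_scaleA c d v :
  tensor_scale c (tensor_scale d v) = tensor_scale (c * d) v.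
Proof.
rewrite -(tensor_sumK v) !tensor_scaleE /scale_sum -map_comp.
by congr tensor_sum; apply: eq_map => -[a f] /=; rewrite mulrA.
Qed.

Lemma tensor_scale1 : left_id 1 tensor_scale.
Proof. by move=> v; rewrite -(tensor_sumK v) tensor_scaleE scale_sum1. Qed.

Lemma tensor_scaleDr : right_distributive tensor_scale +%R.
Proof.
move=> c v w; rewrite -(tensor_sumK v) -(tensor_sumK w) -tensor_sum_cat.
by rewrite !tensor_scaleE /scale_sum map_cat tensor_sum_cat.
Qed.

Lemma tensor_scaleDl v : {morph tensor_scale^~ v : c d / c + d}.
Proof.
move=> c d; rewrite -(tensor_sumK v) !tensor_scaleE -tensor_sum_cat.
exact/tensor_sumP/tensor_eq_scaleD.
Qed.

HB.instance Definition _ := GRing.Zmodule_isLmodule.Build F tensor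
  tensor_scaleA tensor_scale1 tensor_scaleDr tensor_scaleDl.

End Tensor.

Section TensorMap.
Variables (A B : zmodType) (F : fieldType).

Definition tensor_map (f : A -> B) (v : tensor A F) : tensor B F :=
  tensor_sum [seq (f p.1, p.2) | p <- repr v].

Lemma tensor_mapE (f : A -> B) (s : seq (A * F)) :
  {morph f : a b / a + b} ->
  tensor_map f (tensor_sum s) = tensor_sum [seq (f p.1, p.2) | p <- s].
Proof.
move=> fD; apply/tensor_sumP; move: (tensor_eq_repr s); move: (repr _) => t.
elim=> {s t}
  [s|s t _ IH|s t u _ IH1 _ IH2|s s' t t' _ IH1 _ IH2|s t|a b g|a g g'|a].
- exact: tensor_eq_refl.
- exact: tensor_eq_sym.
- exact: tensor_eq_trans IH1 IH2.
- by rewrite !map_cat; apply: tensor_eq_cat.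
- by rewrite !map_cat; apply: tensor_eq_comm.
- by rewrite /= fD; apply: tensor_eq_addl.
- exact: tensor_eq_addr.
- exact: tensor_eq_zero.
Qed.

Lemma tensor_map_linear (f : A -> B) :
  {morph f : a b / a + b} -> linear (tensor_map f).
Proof.
move=> fD c v w; rewrite -(tensor_sumK v) -(tensor_sumK w).
rewrite -[c *: _]/(tensor_scale c _) tensor_scaleE -tensor_sum_cat !tensor_mapE //.
rewrite -[c *: _]/(tensor_scale c _) tensor_scaleE map_cat tensor_sum_cat.
by rewrite /scale_sum -!map_comp.
Qed.

End TensorMap.

Section EndoPoly.
Variables (F : fieldType) (V : lmodType F).

Definition is_basis n (e : 'I_n -> V) : Prop :=
  forall v, exists! r : 'rV[F]_n, v = \sum_i r 0 i *: e i.

Definition coords n (e : 'I_n -> V) (v : V) : 'rV[F]_n :=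
  xget 0 [set r : 'rV[F]_n | v = \sum_i r 0 i *: e i].

Definition endo_matrix n (e : 'I_n -> V) (u : V -> V) : 'M[F]_n :=
  \matrix_(i, j) coords e (u (e j)) 0 i.

Definition basis_det n (e : 'I_n -> V) (u : V -> V) : {poly F} :=
  \det (map_mx polyC (endo_matrix e u) - 'X%:M).

(* For linear u the determinant does not depend on the basis that cid picks. *)
Definition endo_poly (u : V -> V) : {poly F} :=
  if pselect (exists b : {n & 'I_n -> V}, is_basis (projT2 b)) is left ex
  then basis_det (projT2 (projT1 (cid ex))) u else 0.

End EndoPoly.

Section Alexander.
Variables (F : fieldType) (G : cGroup).

Definition alexander_module := tensor (abelianization (ker_nu G)) F.

Definition alexander_action : alexander_module -> alexander_module :=
  tensor_map (ab_map (@ker_conj G (some_cgen G))).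

Definition alexander_poly : {poly F} := endo_poly alexander_action.

End Alexander.

(* Main.v *)
From HB Require Import structures.
Require Import Defs.
From mathcomp Require Import all_boot all_order all_algebra.
From mathcomp Require Import complex.
From mathcomp Require Import boolp classical_sets reals.
From mathcomp Require Import separable cyclotomic.

Set Implicit Arguments.
Unset Strict Implicit.
Unset Printing Implicit Defensive.

Import GRing.Theory Num.Theory.

Local Open Scope ring_scope.

(** Write m = p + 1, let x_0, ..., x_p be the generators of a Hurwitz
    presentation, z their product, N the kernel of nu, V the space obtained
    from N/N' by extension of scalars, and h the action of the generator of
    the infinite cyclic group on V.  Three facts about h give the theorem.

    - Since z is central and nu z = m, the m-th power of h is the identity
      [alexander_action_order]: conjugation by c acts on V through nu c alone
      [alexander_class_conj], and conjugation by z is trivial.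

    - As a module over the polynomials in h, V is generated by the p classes
      f_i of x_0^-1 x_i, 0 < i [alexander_spanned], because G is generated by
      x_0 and the x_0^-1 x_i.

    - The element x_0^-m z of N commutes with x_0, so h fixes its class, which
      is a sum of h^(p - i) f_i [alexander_relation].

    The first two facts make V finite dimensional and h diagonalizable with
    m-th roots of unity as eigenvalues.  A linear form phi with
    phi o h = a phi is determined by its values on the f_i, so every
    eigenvalue has multiplicity at most p = m - 1.  If a <> 1, such a form
    vanishes on the fixed vector of the third fact, which is one nontrivial
    linear condition on the values phi(f_i), with coefficients powers of a; so
    the multiplicity is then at most m - 2 [eigenspace_endo_le].  The product
    of the (t - a)^(m - 2) over the m-th roots of unity, with one extra factor
    t - 1, is (t - 1)(t^m - 1)^(m - 2). *)

(** * Characteristic polynomials of matrices of finite order *)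

Lemma char_poly_simmx (F : fieldType) n (P A B : 'M[F]_n) :
  P \in unitmx -> P *m A = B *m P -> char_poly A = char_poly B.
Proof.
move=> Pu PA; have Pu' : map_mx polyC P \in unitmx by rewrite map_unitmx.
have E : map_mx polyC P *m char_poly_mx A = char_poly_mx B *m map_mx polyC P.
  by rewrite mulmxBr mulmxBl -!map_mxM PA scalar_mxC.
move: (congr1 determinant E); rewrite !det_mulmx [RHS]mulrC.
by apply: mulrI; rewrite -unitmxE.
Qed.

(** The rows of P with index j such that d_j = a are independent eigenvectors
    for a. *)
Lemma card_diag_le_eigenspace (F : fieldType) n (P A : 'M[F]_n) (d : 'rV_n) (a : F) :
  P \in unitmx -> P *m A = diag_mx d *m P ->
  (#|[pred j | d 0%R j == a]| <= \rank (eigenspace A a))%N.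
Proof.
move=> Pu PA; set J := [pred j | _].
pose B := \matrix_(k < #|J|) row (enum_val k) P.
have rowB k : row k B = row (enum_val k) P by rewrite rowK.
have freeB : row_free B.
  apply: inj_row_free => v vB; apply/rowP => k; rewrite !mxE.
  pose w := \sum_l v 0 l *: delta_mx 0 (enum_val l) : 'rV_n.
  have wP : w *m P = 0.
    rewrite -vB mulmx_suml mulmx_sum_row; apply: eq_bigr => l _.
    by rewrite -scalemxAl -rowE rowB.
  have w0 : w = 0 by rewrite -[w](mulmxK Pu) wP mul0mx.
  have := congr1 (fun r : 'rV_n => r 0 (enum_val k)) w0.
  rewrite summxE (bigD1 k) //= big1 ?addr0 => [|l lk].
    by rewrite !mxE !eqxx mulr1.
  by rewrite !mxE eqxx /= (inj_eq enum_val_inj) eq_sym (negPf lk) mulr0.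
rewrite -(eqP freeB); apply/mxrankS/eigenspaceP/row_matrixP => k.
rewrite row_mul rowB -row_mul PA row_mul row_diag_mx -scalemxAl -rowE linearZ /= rowB.
by have /eqP-> : enum_val k \in J by exact: enum_valP.
Qed.

(** In characteristic 0 the polynomial X^m - 1 is separable, hence the roots
    given by algebraic closedness are distinct. *)
Lemma Xn_sub_1_roots (F : numClosedFieldType) m : (0 < m)%N ->
  {rs : seq F | uniq rs & 'X^m - 1 = \prod_(a <- rs) ('X - a%:P)}.
Proof.
move=> m0; have [rs] := closed_field_poly_normal ('X^m - 1 : {poly F}).
rewrite -[X in lead_coef (_ - X)]polyC1 lead_coefXnsubC // scale1r => E; exists rs => //.
rewrite -separable_prod_XsubC -E separable_Xn_sub_1 // pnatr_eq0 -lt0n //.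
Qed.

(** The minimal polynomial of A divides the separable X^m - 1, so A is
    diagonalizable, and the multiplicity of a root of its characteristic
    polynomial is the dimension of the eigenspace. *)
Lemma char_poly_finite_order (F : fieldType) n m (A : 'M[F]_n.+1)
    (rs : seq F) (k : F -> nat) :
  'X^m - 1 = \prod_(a <- rs) ('X - a%:P) -> uniq rs -> A ^+ m = 1 ->
  {in rs, forall a, \rank (eigenspace A a) <= k a}%N ->
  char_poly A %| \prod_(a <- rs) ('X - a%:P) ^+ k a.
Proof.
move=> Ers rsU Am1 rank_le.
have minA : mxminpoly A %| \prod_(a <- rs) ('X - a%:P).
  rewrite -Ers; apply: mxminpoly_min.
  by rewrite rmorphB rmorph1 rmorphXn /= horner_mx_X Am1 subrr.
have [P Pu] : diagonalizable A by apply/diagonalizableP; exists rs.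
move=> /diagonalizable_forPex[d /(simmxP Pu) PA].
have d_rs j : d 0 j \in rs.
  have : (d 0 j) ^+ m = 1.
    have PAm : forall l, P *m A ^+ l = diag_mx d ^+ l *m P.
      elim=> [|l IH]; first by rewrite !expr0 mulmx1 mul1mx.
      by rewrite !exprSr -!mulmxE mulmxA IH -!mulmxA PA.
    have := PAm m; rewrite Am1 mulmx1 => /(congr1 (mulmxr (invmx P))).
    rewrite /= -mulmxA mulmxV // mulmx1.
    have -> : diag_mx d ^+ m = diag_mx (map_mx (fun c => c ^+ m) d).
      elim: (m) => [|l IH].
        by apply/matrixP=> i i'; rewrite expr0 !mxE; case: eqP.
      rewrite exprS IH -mulmxE mulmx_diag; congr diag_mx.
      by apply/rowP => i; rewrite !mxE exprS.
    by move=> /matrixP/(_ j j); rewrite !mxE eqxx.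
  move=> dm; rewrite -root_prod_XsubC -Ers rootE !hornerE ?hornerXn dm.
  by rewrite subrr.
rewrite (char_poly_simmx Pu PA) char_poly_trig ?diag_mx_is_trig //.
(* Group the diagonal entries by value; each of them is one of the roots rs. *)
have -> : \prod_i ('X - (diag_mx d i i)%:P) =
    \prod_(a <- rs) ('X - a%:P) ^+ #|[pred j | d 0 j == a]|.
  under [RHS]eq_bigr => a _ do rewrite -prodr_const big_mkcond.
  rewrite exchange_big; apply: eq_bigr => j _ /=.
  rewrite (bigD1_seq (d 0 j)) //= inE eqxx big1 ?mulr1 ?mxE ?eqxx // => a.
  by rewrite inE eq_sym => /negPf->.
rewrite big_seq [X in _ %| X]big_seq.
elim/big_rec2: _ => // a p q a_rs pq; apply: dvdp_mul => //.
exact/dvdp_exp2l/(leq_trans (card_diag_le_eigenspace a Pu PA))/rank_le.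
Qed.

(** The exponents are the multiplicity bounds for an automorphism generated by
    p vectors with one fixed combination: p at the root 1, p - 1 elsewhere. *)
Lemma prod_Xn_sub_1_pred (F : fieldType) p (rs : seq F) :
  'X^(p.+1) - 1 = \prod_(a <- rs) ('X - a%:P) -> uniq rs ->
  \prod_(a <- rs) ('X - a%:P) ^+ (p - (a != 1)) =
  if p.+1 == 1%N then 1 else ('X - 1) * ('X^(p.+1) - 1) ^+ (p.+1 - 2).
Proof.
case: p => [|p] Ers rsU; first by rewrite big1.
rewrite /= !subSS subn0 Ers -prodrXl.
have rs1 : 1 \in rs.
  by rewrite -root_prod_XsubC -Ers rootE !hornerE ?hornerXn expr1n subrr.
rewrite !(bigD1_seq 1 rs1 rsU) /= eqxx /= subn0 exprS -!mulrA; congr (_ * (_ * _)).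
by apply: eq_bigr => a ->; rewrite subSS subn0.
Qed.

(** * Bases and matrices of endomorphisms *)

(** A nontrivial relation among the f_i expresses one of them through the
    others, which still span; a shortest spanning family is therefore a basis. *)
Lemma is_basis_of_span (F : fieldType) (V : lmodType F) n (f : 'I_n -> V) :
  (forall v, exists r : 'rV[F]_n, v = \sum_i r 0 i *: f i) ->
  exists b : {n & 'I_n -> V}, is_basis (projT2 b).
Proof.
elim: n f => [|n IH] f span.
  exists (existT _ 0%N f) => v; have [r rv] := span v.
  by exists r; split=> // r' _; apply/rowP => -[].
have [[r rf r0]|free] :=
  pselect (exists2 r : 'rV[F]_n.+1, \sum_i r 0 i *: f i = 0 & r != 0); last first.
  exists (existT _ n.+1 f) => v; have [r rv] := span v.
  exists r; split=> // r' r'v; apply/eqP; rewrite -subr_eq0; apply/negPn/negP => nz.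
  apply: free; exists (r - r') => //.
  under eq_bigr => i _ do rewrite !mxE scalerBl.
  by rewrite sumrB -rv -r'v subrr.
have [i ri] : exists i, r 0 i != 0 by apply/rV0Pn.
apply: (IH (f \o lift i)) => v; have [c cv] := span v.
(* Subtract from v the multiple of the relation that cancels f i. *)
exists (\row_j (c 0 (lift i j) - c 0 i / r 0 i * r 0 (lift i j))).
transitivity (\sum_j (c 0 j - c 0 i / r 0 i * r 0 j) *: f j).
  under eq_bigr => j _ do rewrite scalerBl -scalerA.
  by rewrite sumrB -scaler_sumr rf scaler0 subr0.
rewrite (bigD1_ord i) //= mulfVK // subrr scale0r add0r.
by apply: eq_bigr => j _; rewrite mxE.
Qed.

Section Coordinates.
Variables (F : fieldType) (V : lmodType F) (n : nat) (b : 'I_n -> V).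
Hypothesis bB : is_basis b.

Lemma coordsK v : v = \sum_i coords b v 0 i *: b i.
Proof.
rewrite /coords; case: xgetP => [r _ //|no]; have [r [rv _]] := bB v.
by case: (no r).
Qed.

Lemma coords_unique v (r : 'rV[F]_n) : v = \sum_i r 0 i *: b i -> coords b v = r.
Proof.
have [r0 [_ r0U]] := bB v; move=> rv.
by rewrite -(r0U _ rv) -(r0U _ (coordsK v)).
Qed.

Lemma coords_lin c v w : coords b (c *: v + w) = c *: coords b v + coords b w.
Proof.
apply: coords_unique; rewrite {1}(coordsK v) {1}(coordsK w) scaler_sumr -big_split.
by apply: eq_bigr => i _; rewrite !mxE scalerDl scalerA.
Qed.

Lemma coords0 : coords b 0 = 0.
Proof.
by apply: coords_unique; rewrite big1 // => i _; rewrite mxE scale0r.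
Qed.

Lemma coords_sum I (r : seq I) (g : I -> V) :
  coords b (\sum_(i <- r) g i) = \sum_(i <- r) coords b (g i).
Proof.
apply: (big_morph (coords b) _ coords0) => v w.
by rewrite -{1}[v]scale1r coords_lin scale1r.
Qed.

Lemma coords_sum_basis (r : 'rV[F]_n) : coords b (\sum_i r 0 i *: b i) = r.
Proof. exact: coords_unique. Qed.

Lemma coords_endo (u : {linear V -> V}) v :
  (coords b (u v))^T = endo_matrix b u *m (coords b v)^T.
Proof.
rewrite {1}(coordsK v) linear_sum /=.
have -> : coords b (\sum_i u (coords b v 0 i *: b i)) =
    \sum_i coords b v 0 i *: coords b (u (b i)).
  apply: coords_unique.
  under [RHS]eq_bigr => i _ do rewrite summxE scaler_suml.
  rewrite exchange_big; apply: eq_bigr => i _ /=.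
  rewrite linearZ /= {1}(coordsK (u (b i))) scaler_sumr.
  by apply: eq_bigr => j _; rewrite mxE scalerA.
apply/colP => i; rewrite !mxE summxE; apply: eq_bigr => j _.
by rewrite !mxE mulrC.
Qed.

(** A row eigenvector phi of the matrix of u is a linear form on V, read in
    coordinates, whose composite with u is a multiple of it. *)
Lemma coords_iter_endo (u : {linear V -> V}) k v (phi : 'rV[F]_n) a :
  phi *m endo_matrix b u = a *: phi ->
  phi *m (coords b (iter k u v))^T = a ^+ k *: (phi *m (coords b v)^T).
Proof.
move=> phiM; elim: k => [|k IH]; first by rewrite scale1r.
by rewrite iterS coords_endo mulmxA phiM -scalemxAl IH scalerA -exprS.
Qed.

End Coordinates.

(** The family f generates V as a module over the polynomials in u.  The
    induction form avoids introducing submodules, and is the form in which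
    both the proof and the uses take place. *)
Definition endo_spanned (F : fieldType) (V : lmodType F) (u : V -> V) I (f : I -> V) :=
  forall Q : V -> Prop, Q 0 -> (forall a v w, Q v -> Q w -> Q (a *: v + w)) ->
    (forall v, Q v -> Q (u v)) -> (forall i, Q (f i)) -> forall v, Q v.

Section FiniteOrder.
Variables (F : fieldType) (V : lmodType F) (u : {linear V -> V}) (p : nat).
Variable f : 'I_p -> V.
Hypothesis spanV : endo_spanned u f.

(** The vectors u^k (f_i) with k < m.+1 span V, because their span is stable
    under u. *)
Lemma endo_spanned_basis m : (forall v, iter m.+1 u v = v) ->
  exists b : {n & 'I_n -> V}, is_basis (projT2 b).
Proof.
move=> um; pose g (ik : 'I_p * 'I_m.+1) := iter ik.2 u (f ik.1).
pose h (j : 'I_#|{: 'I_p * 'I_m.+1}|) := g (enum_val j).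
pose Q (v : V) := exists c : 'I_p * 'I_m.+1 -> F, v = \sum_ik c ik *: g ik.
have Q0 : Q 0 by exists (fun _ => 0); rewrite big1 // => i _; rewrite scale0r.
have QD a v w : Q v -> Q w -> Q (a *: v + w).
  move=> [c ->] [d ->]; exists (fun ik => a * c ik + d ik).
  rewrite scaler_sumr -big_split; apply: eq_bigr => i _ /=.
  by rewrite scalerDl scalerA.
have Qg ik : Q (g ik).
  exists (fun jl => (jl == ik)%:R); rewrite (bigD1 ik) //= eqxx scale1r big1 ?addr0 //.
  by move=> jl /negPf->; rewrite scale0r.
apply: (@is_basis_of_span _ _ _ h).
suff: forall v, Q v.
  move=> QV v; have [c ->] := QV v; exists (\row_j c (enum_val j)).
  rewrite (reindex _ (onW_bij _ (enum_val_bij _))) /=.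
  by apply: eq_bigr => j _; rewrite mxE.
apply: spanV => // [v [c ->]|i]; last by exact: (Qg (i, ord0)).
rewrite linear_sum /=; under eq_bigr => ik _ do rewrite linearZ /=.
elim/big_ind: _ => // [x y Qx Qy|[i k] _].
  by rewrite -[x]scale1r; exact: QD.
suff Qk : Q (iter k.+1 u (f i)) by rewrite -[_ *: _]addr0; exact: QD.
have [km|km] := ltnP k.+1 m.+1; first exact: (Qg (i, Ordinal km)).
have -> : k.+1 = m.+1 by apply/eqP; rewrite eqn_leq km andbT ltn_ord.
by rewrite um; exact: (Qg (i, ord0)).
Qed.

Variables (n : nat) (b : 'I_n -> V).
Hypothesis bB : is_basis b.

Lemma endo_matrix_order m : (forall v, iter m u v = v) ->
  iter m (mulmx (endo_matrix b u)) 1%:M = 1%:M.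
Proof.
move=> um; set M := endo_matrix b u.
have E k v : (coords b (iter k u v))^T = iter k (mulmx M) 1%:M *m (coords b v)^T.
  elim: k => [|k IH]; first by rewrite mul1mx.
  by rewrite !iterS coords_endo // IH mulmxA.
apply: trmx_inj; apply/row_matrixP => j; rewrite -!tr_col; congr trmx.
have := E m (\sum_i (delta_mx 0 j : 'rV[F]_n) 0 i *: b i).
by rewrite um coords_sum_basis // trmx_delta -!colE col1 => <-.
Qed.

Let E : 'M[F]_(n, p) := \matrix_(i, j) coords b (f j) 0 i.

(** The matrix E evaluates a linear form on the f_i.  It is injective on the
    eigenspace: an eigenform that vanishes on the f_i has a u-stable kernel
    containing them, so it vanishes. *)
Lemma eigenspace_endo_rank a :
  \rank (eigenspace (endo_matrix b u) a *m E) = \rank (eigenspace (endo_matrix b u) a).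
Proof.
apply/mxrank_injP/rowV0P => phi; rewrite sub_capmx => /andP[/eigenspaceP phiM].
move=> /sub_kermxP phiE.
have phi0 v : phi *m (coords b v)^T = 0.
  apply: (spanV (Q := fun v => phi *m (coords b v)^T = 0)).
  - by rewrite coords0 // trmx0 mulmx0.
  - move=> c x y x0 y0; rewrite coords_lin // linearD linearZ /= mulmxDr.
    by rewrite -scalemxAr x0 y0 scaler0 addr0.
  - by move=> x x0; rewrite coords_endo // mulmxA phiM -scalemxAl x0 scaler0.
  - move=> i; transitivity (col i (phi *m E)); last by rewrite phiE col0.
    rewrite colE -mulmxA -colE; congr (_ *m _).
    by apply/colP => j; rewrite !mxE.
apply/rowP => j; have := phi0 (\sum_i (delta_mx 0 j : 'rV[F]_n) 0 i *: b i).
rewrite coords_sum_basis // trmx_delta -colE => /colP/(_ 0).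
by rewrite !mxE.
Qed.

(** For a <> 1 an eigenform vanishes on the fixed vector w, whose value is the
    combination of the values on the f_i with coefficients a^(k i); these are
    nonzero, so one dimension is lost. *)
Lemma eigenspace_endo_le (k : 'I_p -> nat) (a : F)
    (w := \sum_i iter (k i) u (f i)) :
  a != 0 -> u w = w ->
  (\rank (eigenspace (endo_matrix b u) a) <= p - (a != 1%R))%N.
Proof.
move=> a0 uw; rewrite -eigenspace_endo_rank.
have [a1|a1] := eqVneq a 1; first by rewrite subn0 rank_leq_col.
case: (posnP p) => [p0|p_gt0].
  by apply: leq_trans (rank_leq_col _) _; rewrite p0.
pose c := \col_(i < p) a ^+ k i.
have c_neq0 : c != 0.
  apply/eqP => /colP/(_ (Ordinal p_gt0)); rewrite !mxE => /eqP.
  by rewrite expf_eq0 (negPf a0) andbF.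
have rc : \rank c = 1%N.
  by apply/eqP; rewrite eqn_leq rank_leq_col lt0n mxrank_eq0.
suff Ec : eigenspace (endo_matrix b u) a *m E *m c = 0.
  have := mulmx0_rank_max Ec; rewrite rc addn1 => lt_p.
  by rewrite -ltnS subn1 prednK.
set K := eigenspace _ a; rewrite -mulmxA; apply/row_matrixP => j; rewrite row0 row_mul.
have /eigenspaceP KM : (row j K <= K)%MS by exact: row_sub.
set phi := row j K in KM *.
(* phi E c is the value of the form phi on w; since u w = w it equals a times
   itself. *)
have phi_w : phi *m (coords b w)^T = phi *m (E *m c).
  have -> : E *m c = \sum_i a ^+ k i *: (coords b (f i))^T.
    apply/colP => l; rewrite mxE summxE; apply: eq_bigr => i _.
    by rewrite !mxE mulrC.
  rewrite /w coords_sum // linear_sum !mulmx_sumr; apply: eq_bigr => i _ /=.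
  by rewrite (coords_iter_endo bB _ _ KM) -scalemxAr.
have := coords_endo bB u w; rewrite uw => /(congr1 (mulmx phi)).
rewrite mulmxA KM -scalemxAl phi_w => /eqP.
rewrite eq_sym -subr_eq0 -{2}[phi *m _]scale1r -scalerBl scaler_eq0 subr_eq0.
by rewrite (negPf a1) => /eqP.
Qed.

End FiniteOrder.

(** The eigenvalues are roots of X^(p+1) - 1, each at most as often as the
    number of generators allows, and the fixed vector w costs one more
    dimension at every eigenvalue other than 1.  For the Alexander module w is
    provided by the central product of the generators. *)
Lemma endo_poly_finite_order_dvd (F : numClosedFieldType) (V : lmodType F)
    (u : {linear V -> V}) p (f : 'I_p -> V) (k : 'I_p -> nat)
    (w := \sum_i iter (k i) u (f i)) :
  endo_spanned u f -> (forall v, iter p.+1 u v = v) -> u w = w ->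
  endo_poly u %| (if p.+1 == 1%N then 1 else ('X - 1) * ('X^(p.+1) - 1) ^+ (p.+1 - 2)).
Proof.
move=> spanV um uw; rewrite /endo_poly; case: pselect => [ex|[]]; last first.
  exact: endo_spanned_basis spanV _ um.
case: (cid ex) => -[n b] /= bB; rewrite /basis_det.
set M := endo_matrix b u.
case: n => [|n] in b bB M *; first by rewrite det_mx00 dvd1p.
have [rs rsU Ers] := Xn_sub_1_roots F (ltn0Sn p).
(* The opposite sign convention for the characteristic matrix only changes the
   determinant by a unit. *)
have -> : \det (map_mx polyC M - 'X%:M) = (-1) ^+ n.+1 *: char_poly M.
  rewrite -signr_odd -[_ *: _]mul_polyC rmorph_sign signr_odd -detZ; congr determinant.
  by rewrite scaleN1r opprB.
rewrite dvdpZl ?signr_eq0 // -(prod_Xn_sub_1_pred Ers rsU).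
apply: (char_poly_finite_order Ers rsU) => [|a a_rs].
  rewrite -[RHS](endo_matrix_order bB um).
  elim: p.+1 => // m IH; rewrite exprS IH //.
apply: (eigenspace_endo_le spanV bB (k := k)) => //.
apply/eqP => a0; move: a_rs; rewrite -root_prod_XsubC -Ers a0.
by rewrite rootE !hornerE ?hornerXn expr0n /= add0r oppr_eq0 oner_eq0.
Qed.

(** * The Alexander module of a Hurwitz C-group *)

Section AlexanderHurwitz.
Local Open Scope group_scope.

Lemma free_lift_ind (G : groupType) m (x : 'I_m -> G) (P : G -> Prop) :
  (forall g, exists a, free_lift x a = g) ->
  P 1 -> (forall g i, P g -> P (g * x i)) -> (forall g i, P g -> P (g * (x i)^-1)) ->
  forall g, P g.
Proof.
move=> gen P1 PM PV g; have [a <-] := gen g; rewrite /free_lift.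
elim/last_ind: (repr a) => [|w [i e] IH]; first by rewrite /word_eval big_nil.
by rewrite /word_eval -cats1 big_cat big_seq1 /=; case: e; [exact: PM | exact: PV].
Qed.

(** The relations x_i = z^-1 x_i z of a Hurwitz presentation say that z commutes
    with the generators. *)
Lemma hurwitz_prod_central m (G : cGroup) (P : c_presentation m) (x : 'I_m -> G) :
  hurwitz_presentation P -> presents x (cp_relators P) ->
  forall g, commute (\prod_(j < m) x j) g.
Proof.
move=> hP [gen ker]; set z := \prod_j x j.
have lift_z : free_lift x (\prod_(j < m) free_gen j) = z.
  by rewrite gmulf_prod; apply: eq_bigr => j _; exact: free_lift_gen.
have zx i : commute z (x i).
  have [k _ wk] := hP i.
  have /ker : normal_closure (cp_relators P) ((free_gen i)^-1 * free_gen i ^ cp_word k).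
    by move=> A _ PA; apply: PA; exists i, i, k.
  rewrite free_liftM free_liftV free_liftJ free_lift_gen wk lift_z.
  by move=> /eqP; rewrite -commgEl => /commgP/commute_sym.
apply: (free_lift_ind gen); first exact: commute1.
- by move=> g i zg; exact: commuteM.
- by move=> g i zg; apply: commuteM => //; exact: commuteV.
Qed.

Section AlexanderModule.
Variables (F : fieldType) (G : cGroup).

Definition alexander_class (b : ker_nu G) : alexander_module F G :=
  tensor_sum [:: (ab_class b, 1%R)].

Local Notation cl := alexander_class.
Local Notation h := (@alexander_action F G).

Lemma alexander_classM b c : cl (b * c) = (cl b + cl c)%R.
Proof.
rewrite /cl -tensor_sum_cat ab_classM; apply/tensor_sumP; exact: tensor_eq_addl.
Qed.

Lemma alexander_class1 : cl 1 = 0%R.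
Proof. by apply: (addrI (cl 1)); rewrite -alexander_classM mulg1 addr0. Qed.

Lemma alexander_classV b : cl b^-1 = (- cl b)%R.
Proof.
by apply/eqP; rewrite -addr_eq0 -alexander_classM mulVg alexander_class1.
Qed.

Lemma alexander_module_ind (Q : alexander_module F G -> Prop) :
  Q 0%R -> (forall a v w, Q v -> Q w -> Q (a *: v + w)%R) -> (forall b, Q (cl b)) ->
  forall v, Q v.
Proof.
move=> Q0 QD Qcl v; rewrite -(tensor_sumK v).
elim: (repr v) => [//|[a c] s IH]; rewrite -cat1s tensor_sum_cat.
suff -> : tensor_sum [:: (a, c)] = (c *: cl (repr a))%R by exact: QD.
by rewrite [RHS]tensor_scaleE /= mulr1 ab_classK.
Qed.

Lemma alexander_action_linear : linear h.
Proof. exact/tensor_map_linear/ab_mapD. Qed.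

HB.instance Definition _ := GRing.isLinear.Build F _ _ _ h alexander_action_linear.

Lemma alexander_actionE c b : cg_gens c -> h (cl b) = cl (ker_conj c b).
Proof.
move=> cC; rewrite /alexander_action (ab_map_ker_conj (some_cgenP G) cC).
rewrite [LHS]tensor_mapE /= ?ab_mapE //; exact: ab_mapD.
Qed.

(** Conjugation by an element of N is trivial on N/N', so c can be reached by
    multiplying nu c times by one C-generator. *)
Lemma alexander_class_conj k c b : nu c = k%:Z -> cl (ker_conj c b) = iter k h (cl b).
Proof.
have [d dC] := cgen_exists G; move: c; elim: k => [|k IH] c nuc.
  have c0 : in_ker_nu c by rewrite /in_ker_nu nuc.
  pose n : ker_nu G := Sub c c0.
  have -> : ker_conj c b = n^-1 * (b * n) by apply: val_inj.
  by rewrite !alexander_classM alexander_classV addrCA addNr addr0.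
have -> : ker_conj c b = ker_conj d (ker_conj (c * d^-1) b).
  by apply: val_inj; rewrite /= -conjgM mulgVK.
rewrite -alexander_actionE // IH // nuM nuV nuc nu_gen //.
by rewrite intS addrAC subrr add0r.
Qed.

End AlexanderModule.

Section Hurwitz.
Variables (F : fieldType) (G : cGroup) (p : nat) (x : 'I_p.+1 -> G).
Hypothesis gen : forall g, exists a, free_lift x a = g.
Hypothesis xC : forall i, cg_gens (x i).
Let z := \prod_j x j.
Hypothesis zC : forall g, commute z g.

Local Notation cl := (@alexander_class F G).
Local Notation h := (@alexander_action F G).
Local Notation x0 := (x ord0).

Lemma nu_prod (r : seq 'I_p.+1) : nu (\prod_(j <- r) x j) = (size r)%:Z.
Proof.
elim: r => [|i r IH]; first by rewrite big_nil nu1.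
by rewrite big_cons nuM IH nu_gen // intS.
Qed.

Lemma prod_enum : z = \prod_(j <- enum 'I_p.+1) x j.
Proof. by rewrite /z -[index_enum _]enumT. Qed.

Lemma nu_z : nu z = p.+1%:Z.
Proof. by rewrite prod_enum nu_prod size_enum_ord. Qed.

Lemma conj_z g : g ^ z = g.
Proof. by rewrite conjgE -zC mulKg. Qed.

Lemma alexander_action_order v : iter p.+1 h v = v.
Proof.
move: v; apply: alexander_module_ind.
- rewrite -(alexander_class1 F G) -(alexander_class_conj _ _ nu_z).
  by congr cl; exact: ker_conj1.
- move=> a v w hv hw.
  have E k : iter k h (a *: v + w)%R = (a *: iter k h v + iter k h w)%R.
    by elim: k => //= k ->; rewrite linearP.
  by rewrite E hv hw.
- move=> b; rewrite -(alexander_class_conj _ _ nu_z); congr cl.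
  by apply: val_inj; exact: conj_z.
Qed.

Lemma quot_gen_ker i : in_ker_nu (x0^-1 * x i).
Proof. by rewrite /in_ker_nu nuM nuV !nu_gen // addNr. Qed.

Definition quot_gen i : ker_nu G := Sub (x0^-1 * x i) (quot_gen_ker i).

(** Every element of G can be brought, by moving powers of x_0 to the left, to
    the form x_0^j n with n a product of conjugates of the x_0^-1 x_i and of
    their inverses; an element of N has j = 0. *)
Lemma alexander_spanned :
  endo_spanned h (fun i : 'I_p => cl (quot_gen (lift ord0 i))).
Proof.
move=> Q Q0 QD Qh Qf; apply: alexander_module_ind => // b.
have QS v w : Q v -> Q w -> Q (v + w)%R.
  by move=> Qv Qw; rewrite -[v]scale1r; exact: QD.
have QN v : Q v -> Q (- v)%R.
  by move=> Qv; rewrite -[(- v)%R]addr0 -scaleN1r; exact: QD.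
have Qiter k v : Q v -> Q (iter k h v) by move=> Qv; elim: k => //= k; exact: Qh.
have Qgen i : Q (cl (quot_gen i)).
  case: (unliftP ord0 i) => [j ->|->] //.
  have -> : quot_gen ord0 = 1 by apply: val_inj; rewrite /= mulVg.
  by rewrite alexander_class1.
have Qconj c n : Q (cl n) -> Q (cl (ker_conj c n)).
  have [k [nuc|nuc]] : exists k : nat, nu c = k%:Z \/ nu c = (- k%:Z)%R.
    by case: (nu c) => k; [exists k; left | exists k.+1; right; rewrite NegzE].
    by move=> Qn; rewrite (alexander_class_conj _ _ nuc); exact: Qiter.
  (* The central z turns a conjugation of negative degree into one of
     nonnegative degree. *)
  have -> : ker_conj c n = ker_conj (c * z ^+ k) n.
    apply: val_inj; rewrite /= conjgM; elim: k {nuc} => [|k IH]; first by rewrite conjg1.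
    by rewrite expgSr conjgM -IH conj_z.
  have nucz : nu (c * z ^+ k) = (p * k)%:Z.
    rewrite nuM nuc.
    have -> : nu (z ^+ k) = (p.+1 * k)%:Z.
      elim: k {nuc} => [|k IH]; first by rewrite nu1 muln0.
      by rewrite expgS nuM IH nu_z mulnS PoszD.
    by rewrite mulSn PoszD addKr.
  by move=> Qn; rewrite (alexander_class_conj _ _ nucz); exact: Qiter.
(* T g says that g is x_0^(k - l) n with the class of n in Q; keeping both
   exponents avoids integer powers. *)
pose T g := exists k l (n : ker_nu G), x0 ^+ k * val n = x0 ^+ l * g /\ Q (cl n).
suff: T (val b).
  move=> [k [l [n [E Qn]]]].
  have nuX j : nu (x0 ^+ j) = j%:Z.
    by elim: j => [|j IH]; rewrite ?nu1 // expgS nuM IH nu_gen // intS.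
  have := congr1 (@nu G) E; rewrite !nuM !nuX.
  have /eqP-> : nu (val n) == 0%R by exact: (valP n).
  have /eqP-> : nu (val b) == 0%R by exact: (valP b).
  rewrite !addr0 => -[kl]; move: E; rewrite kl => /mulgI/val_inj <- //.
move: (val b); apply: (free_lift_ind gen).
- by exists 0%N, 0%N, 1; rewrite alexander_class1.
- move=> g i [k [l [n [E Qn]]]].
  exists k.+1, l, (ker_conj x0 n * quot_gen i); split.
    by rewrite /= expgSr conjgE -!mulgA !mulVKg !mulgA E.
  by rewrite alexander_classM; apply: QS => //; exact: Qconj.
- move=> g i [k [l [n [E Qn]]]].
  exists k, l.+1, (ker_conj x0^-1 (n * (quot_gen i)^-1)); split.
    rewrite /= conjgE invgM !invgK -!mulgA mulgV mulg1 mulgA -expgSr !expgS -!mulgA.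
    by congr (_ * _); rewrite !mulgA E.
  by apply: Qconj; rewrite alexander_classM alexander_classV; apply/QS/QN.
Qed.

(** Collecting the factors x_0 of z = x_0 x_1 ... x_p on the left gives
    z = x_0^m n, where the class of n is the sum w; and n = x_0^-m z commutes
    with x_0 because z does. *)
Lemma alexander_relation :
  let w := (\sum_(i < p) iter (p - i.+1) h (cl (quot_gen (lift ord0 i))))%R in
  h w = w.
Proof.
(* Moving x_0 to the left past n applies h to the class of n.  The induction
   needs arbitrary products of generators instead of z. *)
have step (r : seq 'I_p.+1) :
  exists2 n : ker_nu G, \prod_(j <- r) x j = x0 ^+ size r * val n &
    cl n = (\sum_(k < size r) iter (size r - k.+1) h (cl (quot_gen (nth ord0 r k))))%R.
  elim/last_ind: r => [|r i [n En cln]].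
    by exists 1; rewrite ?big_nil ?mulg1 // big_ord0 alexander_class1.
  exists (ker_conj x0 n * quot_gen i).
    rewrite -cats1 big_cat big_seq1 /= En size_cat addn1 expgSr conjgE.
    by rewrite -!mulgA !mulVKg.
  rewrite alexander_classM -(alexander_actionE _ n (xC ord0)) cln size_rcons.
  rewrite big_ord_recr /= subnn nth_rcons ltnn eqxx linear_sum /=; congr (_ + _)%R.
  by apply: eq_bigr => k _; rewrite nth_rcons ltn_ord subSn // iterS.
have [n En cln] := step (enum 'I_p.+1).
move: En cln; rewrite -prod_enum size_enum_ord big_ord_recl nth_ord_enum.
move=> En cln w.
have cl0 : cl (quot_gen ord0) = 0%R.
  have -> : quot_gen ord0 = 1 by apply: val_inj; rewrite /= mulVg.
  exact: alexander_class1.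
have -> : w = cl n.
  rewrite cln cl0; have -> : iter (p.+1 - 1) h 0%R = 0%R.
    by elim: (p.+1 - 1)%N => //= k ->; rewrite linear0.
  rewrite add0r; apply: eq_bigr => i _; rewrite subSS.
  by rewrite (nth_ord_enum ord0 (lift ord0 i)).
rewrite (alexander_actionE _ n (xC ord0)); congr cl; apply: val_inj => /=.
have -> : val n = x0 ^- p.+1 * z by rewrite En mulKg.
apply/conjg_fixP/commgP/commute_sym; apply: commuteM; last exact/commute_sym.
by apply/commuteV/commuteX.
Qed.

End Hurwitz.

End AlexanderHurwitz.

(* For m = 1 the exponent m - 2 is -1 and (t - 1)(t - 1)^-1 is the constant 1. *)
Theorem theorem5p6 (R : realType) (m : nat) (G : cGroup)
    (hG : hurwitz_cgroup m G) :
  alexander_poly R[i] G %|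
    (if m == 1%N then 1 else ('X - 1) * ('X^m - 1) ^+ (m - 2)).
Proof.
case: hG => P hP [x pres Cx].
have xC i : cg_gens (x i) by rewrite Cx; exists i, 1%g; rewrite conjg1.
case: m => [|p] in P x hP pres Cx xC *.
  (* Without generators G has no C-generator, a contradiction. *)
  by have [c] := cgen_exists G; rewrite Cx => -[[]].
have zC := hurwitz_prod_central hP pres.
exact: (@endo_poly_finite_order_dvd R[i] _ (@alexander_action R[i] G) p _ _
  (@alexander_spanned R[i] G p x pres.1 xC zC)
  (alexander_action_order xC zC) (alexander_relation _ xC zC)).
Qed.
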